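(* Let $G$ be a finite group and $f\colon G\to\mathbb{R}$ any function. Then $\|f\| = \|f\|_{\mathsf G}$.
   Context: All averages use the uniform measure: $\mathbb{E}_{g\in G}$ denotes $\frac{1}{|G|}\sum_{g\in G}$, and for $x\colon G\to\mathbb{R}$, $\|x\|_2 = (\mathbb{E}_{g\in G}|x(g)|^2)^{1/2}$. The spectral norm of $f$ is $\|f\| = \sup \left|\mathbb{E}_{g,h\in G} f(gh^{-1})x(g)y(h)\right|$ over all $x,y\colon G\to\mathbb{R}$ with $\|x\|_2,\|y\|_2\le 1$. The Grothendieck norm of $f$ is $\|f\|_{\mathsf G} = \sup \left|\mathbb{E}_{g,h\in G} f(gh^{-1})\langle x(g),y(h)\rangle\right|$, the supremum over all real Hilbert spaces $\mathbb{H}$ and all maps $x,y\colon G\to B(\mathbb{H})$, where $B(\mathbb{H})$ is the closed unit ball of $\mathbb{H}$. *)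

(* Defs.v *)
From HB Require Import structures.
From mathcomp Require Import all_boot all_order all_algebra all_fingroup.
From mathcomp Require Import sesquilinear.
From mathcomp Require Import all_classical all_reals all_analysis.

Set Implicit Arguments.
Unset Strict Implicit.
Unset Printing Implicit Defensive.

Import Order.TTheory GRing.Theory Num.Theory.
Import numFieldNormedType.Exports.

Local Open Scope classical_set_scope.
Local Open Scope ring_scope.

(* With theta := idfun, a [{dot U for idfun}] is a symmetric, positive
   definite bilinear form. *)
Record hilbertSpace (R : realType) := HilbertSpace {
  hilbert_carrier :> completeNormedModType R;
  inner : {dot hilbert_carrier for idfun};
  inner_normE : forall u : hilbert_carrier, inner u u = `|u| ^+ 2
}.

Definition unit_ball (R : realType) (H : hilbertSpace R) : set H :=
  [set u | `|u| <= 1].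

Definition avg (R : realType) (T : finType) (F : T -> R) : R :=
  (#|T|%:R)^-1 * \sum_(t : T) F t.

Definition l2norm (R : realType) (T : finType) (x : T -> R) : R :=
  Num.sqrt (avg (fun t => `|x t| ^+ 2)).

(* Both norms are suprema in the extended reals, so that no default value is
   involved. *)
Definition spectral_norm (R : realType) (G : finGroupType) (f : G -> R)
    : \bar R :=
  ereal_sup [set v | exists x y : G -> R,
    [/\ l2norm x <= 1, l2norm y <= 1 &
        v = `| avg (fun g => avg (fun h =>
                 f (g * h^-1)%g * x g * y h)) |%:E]].

Definition grothendieck_norm (R : realType) (G : finGroupType) (f : G -> R)
    : \bar R :=
  ereal_sup [set v | exists (H : hilbertSpace R) (x y : G -> H),
    [/\ forall g, unit_ball (x g), forall h, unit_ball (y h) &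
        v = `| avg (fun g => avg (fun h =>
                 f (g * h^-1)%g * inner H (x g) (y h))) |%:E]].

(* Main.v *)
(* Given [x, y : G -> R], the translates [t |-> x (g t)] and [t |-> y (h t)] lie
   in the ball of L^2(G) of radius [l2norm x], resp. [l2norm y], and since
   [(g t) (h t)^-1 = g h^-1] averaging over [t] turns the scalar form into the
   Hilbert space one; hence spectral <= Grothendieck. Conversely, coordinates
   [a k] in an orthonormal basis of the span of two families in the unit ball
   write the Hilbert space form as a sum of scalar forms, each at most
   [||f|| (||x_k||^2 + ||y_k||^2) / 2], and the squared norms of the coordinate
   functions sum to at most 1. *)
From HB Require Import structures.
Require Import Defs.
From mathcomp Require Import all_boot all_order all_algebra all_fingroup.
From mathcomp Require Import sesquilinear ring lra.
From mathcomp Require Import all_classical all_reals all_analysis.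

Set Implicit Arguments.
Unset Strict Implicit.
Unset Printing Implicit Defensive.

Import Order.TTheory GRing.Theory Num.Theory.
Import numFieldNormedType.Exports.

Local Open Scope classical_set_scope.
Local Open Scope ring_scope.

(** * Averages over a finite type *)

Lemma eq_avg (R : realType) (T : finType) (F F' : T -> R) :
  F =1 F' -> avg F = avg F'.
Proof. by move=> eqF; rewrite /avg (eq_bigr _ (fun t _ => eqF t)). Qed.

Lemma avgD (R : realType) (T : finType) (F F' : T -> R) :
  avg (fun t => F t + F' t) = avg F + avg F'.
Proof. by rewrite /avg big_split mulrDr. Qed.

Lemma avgZ (R : realType) (T : finType) (a : R) (F : T -> R) :
  avg (fun t => a * F t) = a * avg F.
Proof. by rewrite /avg -mulr_sumr mulrCA. Qed.

Lemma avg_sum (R : realType) (T : finType) (n : nat) (F : nat -> T -> R) :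
  avg (fun t => \sum_(k < n) F k t) = \sum_(k < n) avg (F k).
Proof. by rewrite /avg exchange_big mulr_sumr. Qed.

Lemma exchange_avg (R : realType) (S T : finType) (F : S -> T -> R) :
  avg (fun s => avg (F s)) = avg (fun t => avg (fun s => F s t)).
Proof.
by rewrite /avg -!mulr_sumr exchange_big mulrCA.
Qed.

Lemma avg_ge0 (R : realType) (T : finType) (F : T -> R) :
  (forall t, 0 <= F t) -> 0 <= avg F.
Proof. by move=> F0; rewrite mulr_ge0 ?invr_ge0 ?ler0n ?sumr_ge0. Qed.

Lemma avg_le1 (R : realType) (T : finType) (F : T -> R) :
  (forall t, F t <= 1) -> avg F <= 1.
Proof.
(* On an empty type the convention [0^-1 = 0] makes the average [0]. *)
move=> F1; rewrite /avg; have [/eqP T0|T0] := boolP (#|T| == 0%N).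
  by rewrite T0 invr0 mul0r.
rewrite ler_pdivrMl ?ltr0n ?lt0n // mulr1.
apply: (le_trans (ler_sum _ (fun t _ => F1 t))).
by rewrite big_const iter_addr_0.
Qed.

Lemma avg_cst (R : realType) (G : finGroupType) (a : R) :
  avg (fun _ : G => a) = a.
Proof.
rewrite /avg sumr_const -[a *+ _]mulr_natl mulrA mulVf ?mul1r // pnatr_eq0 -lt0n.
by rewrite -cardsT cardG_gt0.
Qed.

Lemma avg_mulgr (R : realType) (G : finGroupType) (F : G -> R) (t : G) :
  avg (fun g => F (g * t)%g) = avg F.
Proof.
by rewrite /avg [in RHS](reindex_inj (mulIg t)).
Qed.

Lemma avg_sqr_eq0 (R : realType) (T : finType) (x : T -> R) :
  avg (fun t => x t * x t) = 0 -> forall t, x t = 0.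
Proof.
move=> /eqP + t; rewrite mulf_eq0 invr_eq0 pnatr_eq0.
rewrite eqn0Ngt (_ : (0 < #|T|)%N = true) /=; last by apply/card_gt0P; exists t.
rewrite psumr_eq0 => [|s _]; last by rewrite -expr2 sqr_ge0.
by move/allP/(_ t (mem_index_enum t)); rewrite mulf_eq0 orbb => /eqP.
Qed.

(** With [a], [b], [c] the averages of [x y], [x x], [y y], the average of [(c x - a y)^2] equals
    [c (b c - a^2)]. Its nonnegativity suffices when [c > 0]; when [c = 0], [y] vanishes
    everywhere. *)
Lemma avg_cauchy_schwarz (R : realType) (T : finType) (x y : T -> R) :
  avg (fun t => x t * y t) ^+ 2 <=
  avg (fun t => x t * x t) * avg (fun t => y t * y t).
Proof.
set a := avg _; set b := avg _; set c := avg _.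
have := @avg_ge0 R T (fun t => y t * y t) (fun t => sqr_ge0 (y t)).
rewrite -/c le_eqVlt => /predU1P[c0|c0].
  rewrite /a (_ : avg _ = 0) ?expr0n /= -?c0 ?mulr0 //.
  under eq_avg => t do rewrite (avg_sqr_eq0 (esym c0)) mulr0 -(mulr0 0).
  by rewrite avgZ mul0r.
have: 0 <= avg (fun t => (c * x t - a * y t) ^+ 2).
  by apply: avg_ge0 => t; exact: sqr_ge0.
under eq_avg => t.
  rewrite (_ : _ ^+ 2 = c ^+ 2 * (x t * x t) +
    ((- 2 * a * c) * (x t * y t) + a ^+ 2 * (y t * y t))); last by ring.
  over.
rewrite !avgD !avgZ -/a -/b -/c.
rewrite (_ : _ + _ = c * (b * c - a ^+ 2)); last by ring.
by rewrite pmulr_rge0 // subr_ge0.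
Qed.

(** * The Hilbert space L^2(T) of the averaged inner product *)

Definition l2space (R : realType) (T : finType) : Type := {ffun T -> R^o}.

HB.instance Definition _ (R : realType) (T : finType) :=
  GRing.Lmodule.on (l2space R T).

Definition l2inner (R : realType) (T : finType) (x y : l2space R T) : R :=
  avg (fun t => (x t : R) * y t).

Definition l2space_norm (R : realType) (T : finType) (x : l2space R T) : R :=
  Num.sqrt (l2inner x x).

Lemma l2innerC (R : realType) (T : finType) (x y : l2space R T) :
  l2inner x y = l2inner y x.
Proof. by apply: eq_avg => t; rewrite mulrC. Qed.

Lemma l2innerD (R : realType) (T : finType) (x x' y : l2space R T) :
  l2inner (x + x') y = l2inner x y + l2inner x' y.
Proof.
by rewrite /l2inner -avgD; apply: eq_avg => t; rewrite !ffunE mulrDl.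
Qed.

Lemma l2innerZ (R : realType) (T : finType) (a : R) (x y : l2space R T) :
  l2inner (a *: x) y = a * l2inner x y.
Proof.
by rewrite /l2inner -avgZ; apply: eq_avg => t; rewrite !ffunE -mulrA.
Qed.

Lemma l2inner_ge0 (R : realType) (T : finType) (x : l2space R T) :
  0 <= l2inner x x.
Proof. by apply: avg_ge0 => t; rewrite -expr2 sqr_ge0. Qed.

Lemma ler_l2space_normD (R : realType) (T : finType) (x y : l2space R T) :
  l2space_norm (x + y) <= l2space_norm x + l2space_norm y.
Proof.
have nE z : l2inner z z = l2space_norm z ^+ 2 by rewrite sqr_sqrtr ?l2inner_ge0.
have n0 z : 0 <= @l2space_norm R T z by rewrite sqrtr_ge0.
rewrite -ler_sqr ?nnegrE ?addr_ge0 ?n0 // -nE.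
rewrite l2innerD ![l2inner _ (x + y)]l2innerC !l2innerD (l2innerC y x).
suff : l2inner x y <= l2space_norm x * l2space_norm y.
  by rewrite !nE; nra.
apply: le_trans (ler_norm _) _.
rewrite -ler_sqr ?nnegrE ?mulr_ge0 ?n0 // exprMn -!nE.
by rewrite real_normK ?num_real // avg_cauchy_schwarz.
Qed.

Lemma l2space_normZ (R : realType) (T : finType) (a : R) (x : l2space R T) :
  l2space_norm (a *: x) = `|a| * l2space_norm x.
Proof.
rewrite /l2space_norm l2innerZ l2innerC l2innerZ mulrA -expr2.
by rewrite sqrtrM ?sqr_ge0 // sqrtr_sqr.
Qed.

Lemma l2space_norm_eq0 (R : realType) (T : finType) (x : l2space R T) :
  l2space_norm x = 0 -> x = 0.
Proof.
move/eqP; rewrite sqrtr_eq0 => x0; apply/ffunP => t; rewrite ffunE.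
apply: (@avg_sqr_eq0 _ _ (fun t => x t : R)).
by apply/eqP; rewrite eq_le x0 l2inner_ge0.
Qed.

HB.instance Definition _ (R : realType) (T : finType) :=
  @Lmodule_isNormed.Build R (l2space R T) (@l2space_norm R T)
    (@ler_l2space_normD R T) (@l2space_normZ R T) (@l2space_norm_eq0 R T).

(** One square is at most the sum of all squares, which is [#|T|] times their average. So evaluation
    at [t] is Lipschitz and sends Cauchy filters to Cauchy filters. *)
Lemma coord_le_l2space_norm (R : realType) (T : finType) (x : l2space R T) (t : T) :
  `|x t : R| <= Num.sqrt #|T|%:R * `|x|.
Proof.
have T0 : (0 < #|T|)%N by apply/card_gt0P; exists t.
rewrite -sqrtrM ?ler0n // /l2inner /avg mulVKf ?pnatr_eq0 -?lt0n //.
rewrite -sqrtr_sqr ler_wsqrtr // (bigD1 t) //= -expr2 lerDl.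
by apply: sumr_ge0 => s _; rewrite -expr2 sqr_ge0.
Qed.

Lemma l2space_norm_le_coord (R : realType) (T : finType) (x : l2space R T) (e : R) :
  0 <= e -> (forall t, `|x t : R| <= e) -> `|x| <= e.
Proof.
move=> e0 xe; rewrite -[e]ger0_norm // -sqrtr_sqr ler_wsqrtr //.
(* The general case divides by [e ^+ 2], so [e = 0] is treated apart. *)
have [e00|en0] := eqVneq e 0.
  rewrite e00 expr0n /= /l2inner (eq_avg (F' := fun t => 0 * 0)).
    by rewrite avgZ mul0r.
  move=> t; suff -> : x t = 0 :> R by rewrite mulr0.
  by apply/eqP; rewrite -normr_le0 -e00.
have : avg (fun t => e ^- 2 * (x t * x t : R)) <= 1.
  apply: avg_le1 => t; rewrite ler_pdivrMl ?exprn_gt0 ?lt_def ?en0 //.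
  by rewrite mulr1 -expr2 -[leLHS]real_normK ?num_real // ler_sqr ?nnegrE.
by rewrite avgZ ler_pdivrMl ?mulr1 // exprn_gt0 // lt_def en0.
Qed.

(** The limit is taken coordinatewise. As [T] is finite, the coordinates are eventually all within
    [e] of their limits at once, which bounds the L^2 distance by [e]. *)
Lemma l2space_complete (R : realType) (T : finType) (F : set_system (l2space R T)) :
  ProperFilter F -> cauchy F -> cvg F.
Proof.
move=> FF /cauchy_ballP Fc.
have cF (t : T) : cvg ((fun x : l2space R T => x t : R) @ F).
  apply: cauchy_cvg; apply/cauchy_ballP => e e0.
  have k0 : 0 < Num.sqrt (#|T|%:R : R).
    by rewrite sqrtr_gt0 ltr0n; apply/card_gt0P; exists t.
  rewrite near_map2.
  apply: filterS (Fc _ (divr_gt0 e0 k0)) => -[x y] /=.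
  rewrite -!ball_normE /= => xy.
  rewrite (_ : x t - y t = (x - y) t); last by rewrite !ffunE.
  apply: le_lt_trans (coord_le_l2space_norm _ _) _.
  by rewrite mulrC -ltr_pdivlMr.
apply/cvg_ex; exists [ffun t => lim ((fun x : l2space R T => x t : R) @ F)].
apply/cvgrPdist_le => e e0.
have : \forall x \near F, forall t,
    `|lim ((fun x : l2space R T => x t : R) @ F) - (x : l2space R T) t| <= e.
  by apply: filter_forall => t; move/cvgrPdist_le : (cF t) => /(_ _ e0).
apply: filterS => x xe; apply: l2space_norm_le_coord; first exact: ltW.
by move=> t; rewrite !ffunE.
Qed.

HB.instance Definition _ (R : realType) (T : finType) :=
  Uniform_isComplete.Build (l2space R T) (@l2space_complete R T).

Lemma l2inner_zmod_morphisml (R : realType) (T : finType) (y : l2space R T) :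
  zmod_morphism ((@l2inner R T)^~ y).
Proof. by move=> x x' /=; rewrite l2innerD -scaleN1r l2innerZ mulN1r. Qed.

Lemma l2inner_zmod_morphismr (R : realType) (T : finType) (x : l2space R T) :
  zmod_morphism (@l2inner R T x).
Proof.
by move=> y y'; rewrite !(l2innerC x) l2inner_zmod_morphisml.
Qed.

Lemma l2innerZr (R : realType) (T : finType) (x : l2space R T) :
  scalable_for (idfun \; *%R) (@l2inner R T x).
Proof. by move=> a y; rewrite !(l2innerC x) l2innerZ. Qed.

HB.instance Definition _ (R : realType) (T : finType) :=
  @isBilinear.Build R (l2space R T) (l2space R T) R *%R (idfun \; *%R)
    (@l2inner R T) (@l2inner_zmod_morphisml R T) (@l2inner_zmod_morphismr R T)
    (fun y a x => l2innerZ a x y) (@l2innerZr R T).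

Lemma l2inner_herm (R : realType) (T : finType) (x y : l2space R T) :
  l2inner x y = (-1) ^+ false * idfun (l2inner y x).
Proof. by rewrite mul1r l2innerC. Qed.

HB.instance Definition _ (R : realType) (T : finType) :=
  @isHermitianSesquilinear.Build R (l2space R T) false idfun
    (@l2inner R T) (@l2inner_herm R T).

Lemma l2innerE (R : realType) (T : finType) (x : l2space R T) :
  l2inner x x = `|x| ^+ 2.
Proof. by rewrite sqr_sqrtr ?l2inner_ge0. Qed.

Lemma l2inner_gt0 (R : realType) (T : finType) (x : l2space R T) :
  x != 0 -> 0 < l2inner x x.
Proof. by move=> x0; rewrite l2innerE exprn_gt0 ?normr_gt0. Qed.

HB.instance Definition _ (R : realType) (T : finType) :=
  @isDotProduct.Build R (l2space R T) (@l2inner R T) (@l2inner_gt0 R T).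

Definition l2hilbert (R : realType) (T : finType) : hilbertSpace R :=
  @HilbertSpace R (l2space R T) (@l2inner R T) (@l2innerE R T).

(** * Coordinates for finite families in a Hilbert space *)

Lemma innerC (R : realType) (H : hilbertSpace R) (u v : H) :
  inner H u v = inner H v u.
Proof. by rewrite (hermitian_subproof u v) expr0 mul1r. Qed.

Lemma innerBZ (R : realType) (H : hilbertSpace R) (a : R) (u v w : H) :
  inner H (u - a *: v) w = inner H u w - a * inner H v w.
Proof. by rewrite linearBl linearZl_LR. Qed.

(** Induction on [s]: projecting off the head vector splits the Gram matrix into a rank-one part,
    which gives one coordinate, and the Gram matrix of the projections, handled by induction. The
    vectors may be linearly dependent. *)
Lemma gram_factorization (R : realType) (H : hilbertSpace R) (I : eqType)
    (s : seq I) (v : I -> H) :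
  exists (n : nat) (a : nat -> I -> R),
    {in s &, forall i j, inner H (v i) (v j) = \sum_(k < n) a k i * a k j}.
Proof.
elim: s v => [|t s IH] v; first by exists 0%N, (fun _ _ => 0).
(* One Gram-Schmidt step: [w] is [v] projected off the line of [v t]. *)
set N := inner H (v t) (v t); pose c i := inner H (v i) (v t) / N.
pose w i := v i - c i *: v t.
have N_eq0 : N = 0 -> v t = 0.
  by move/eqP; rewrite /N inner_normE sqrf_eq0 normr_eq0 => /eqP.
have N_ge0 : 0 <= N by rewrite /N inner_normE sqr_ge0.
(* For [N = 0] the quotient [c i] is a default value, but then [v t = 0] and both sides vanish. *)
have cN i : c i * N = inner H (v i) (v t).
  have [N0|N0] := eqVneq N 0; last by rewrite /c divfK.
  by rewrite N0 mulr0 (N_eq0 N0) linear0r.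
have wt : w t = 0.
  have [N0|N0] := eqVneq N 0; first by rewrite /w (N_eq0 N0) scaler0 subr0.
  by rewrite /w /c divff // scale1r subrr.
have vE i j : inner H (v i) (v j) = c i * c j * N + inner H (w i) (w j).
  rewrite /w innerBZ !(innerC _ (v j - _)) !innerBZ -/N.
  rewrite (innerC (v j) (v i)) (innerC (v t) (v i)) -!cN.
  by ring.
have [n [b bE]] := IH w.
(* Coordinate [0] is the component along the normalized [v t]. The others come from [b], which is
   controlled only on the tail [s]; at [t] they are set to [0], in accordance with [w t = 0]. *)
exists n.+1, (fun k i => if k is k'.+1 then if i == t then 0 else b k' i
                         else c i * Num.sqrt N).
move=> i j; rewrite !inE vE big_ord_recl /= => it jt; congr (_ + _).
  by rewrite [RHS]mulrACA -[Num.sqrt N * _]expr2 sqr_sqrtr.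
have [->|it'] := eqVneq i t.
  by rewrite wt linear0l big1 // => k _; rewrite mul0r.
have [->|jt'] := eqVneq j t.
  by rewrite wt linear0r big1 // => k _; rewrite mulr0.
by apply: bE; [move: it|move: jt]; rewrite ?(negPf it') ?(negPf jt').
Qed.

(** * The scalar form and its homogeneity *)

Definition group_form (R : realType) (G : finGroupType) (f x y : G -> R) : R :=
  avg (fun g => avg (fun h => f (g * h^-1)%g * x g * y h)).

Lemma group_formZ (R : realType) (G : finGroupType) (f x y : G -> R) (a b : R) :
  group_form f (fun g => a * x g) (fun h => b * y h) =
  a * b * group_form f x y.
Proof.
rewrite /group_form -avgZ; apply: eq_avg => g.
by rewrite -avgZ; apply: eq_avg => h; ring.
Qed.

Lemma l2norm_ge0 (R : realType) (T : finType) (x : T -> R) : 0 <= l2norm x.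
Proof. exact: sqrtr_ge0. Qed.

Lemma l2norm_sqr (R : realType) (T : finType) (x : T -> R) :
  l2norm x ^+ 2 = avg (fun t => x t * x t).
Proof.
rewrite sqr_sqrtr; last by apply: avg_ge0 => t; rewrite sqr_ge0.
by apply: eq_avg => t; rewrite real_normK ?num_real.
Qed.

Lemma l2normZ (R : realType) (T : finType) (a : R) (x : T -> R) :
  l2norm (fun t => a * x t) = `|a| * l2norm x.
Proof.
rewrite -[RHS]ger0_norm ?mulr_ge0 ?l2norm_ge0 // -sqrtr_sqr exprMn l2norm_sqr.
rewrite -avgZ; congr (Num.sqrt _); apply: eq_avg => t.
by rewrite normrM exprMn !real_normK ?num_real.
Qed.

Lemma l2norm_eq0 (R : realType) (T : finType) (x : T -> R) :
  l2norm x = 0 -> forall t, x t = 0.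
Proof. by move=> x0; apply: avg_sqr_eq0; rewrite -l2norm_sqr x0 expr0n. Qed.

(** Normalize [x] and [y] and use bilinearity. A function of norm zero cannot be normalized, but it
    vanishes pointwise, and so does the form. *)
Lemma group_form_le (R : realType) (G : finGroupType) (f : G -> R) (c : R) :
  (forall x y, l2norm x <= 1 -> l2norm y <= 1 -> `|group_form f x y| <= c) ->
  forall x y, `|group_form f x y| <= c * (l2norm x * l2norm y).
Proof.
move=> fc x y.
have [x0|x0] := eqVneq (l2norm x) 0.
  have xE : x = fun g => 0 * x g.
    by apply/funext => g; rewrite (l2norm_eq0 x0) mulr0.
  have yE : y = fun g => 1 * y g by apply/funext => g; rewrite mul1r.
  by rewrite {1}xE {1}yE group_formZ !mul0r normr0 x0 mul0r mulr0.
have [y0|y0] := eqVneq (l2norm y) 0.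
  have yE : y = fun g => 0 * y g.
    by apply/funext => g; rewrite (l2norm_eq0 y0) mulr0.
  have xE : x = fun g => 1 * x g by apply/funext => g; rewrite mul1r.
  by rewrite {1}xE {1}yE group_formZ mulr0 mul0r normr0 y0 !mulr0.
have xy : 0 < l2norm x * l2norm y.
  by rewrite mulr_gt0 // lt_def ?x0 ?y0 l2norm_ge0.
have u (z : G -> R) : l2norm z != 0 -> l2norm (fun g => (l2norm z)^-1 * z g) <= 1.
  by move=> z0; rewrite l2normZ ger0_norm ?invr_ge0 ?l2norm_ge0 // mulVf.
have := fc _ _ (u _ x0) (u _ y0).
rewrite group_formZ -invfM normrM gtr0_norm ?invr_gt0 //.
by rewrite ler_pdivrMl // mulrC.
Qed.

(** * Comparison of the two norms *)

Lemma group_form_l2inner (R : realType) (G : finGroupType) (f x y : G -> R) :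
  group_form f x y =
  avg (fun g => avg (fun h => f (g * h^-1)%g *
    l2inner [ffun t => x (g * t)%g] [ffun t => y (h * t)%g])).
Proof.
(* A dummy average over [t] is inserted, [g] and [h] are replaced by [g t] and [h t], and the
   average over [t] is then moved innermost. *)
rewrite -[LHS](@avg_cst R G).
transitivity (avg (fun t : G => avg (fun g => avg (fun h =>
   f (g * h^-1)%g * x (g * t)%g * y (h * t)%g)))).
  apply: eq_avg => t; rewrite /group_form -(avg_mulgr _ t); apply: eq_avg => g.
  rewrite -(avg_mulgr _ t); apply: eq_avg => h.
  by rewrite invMg mulgA mulgK.
rewrite [LHS]exchange_avg; apply: eq_avg => g.
rewrite [LHS]exchange_avg; apply: eq_avg => h.
rewrite -avgZ; apply: eq_avg => t.
by rewrite !ffunE mulrA.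
Qed.

Lemma spectral_le_grothendieck (R : realType) (G : finGroupType) (f : G -> R) :
  (spectral_norm f <= grothendieck_norm f)%E.
Proof.
apply: le_ereal_sup => _ [x [y [x1 y1 ->]]].
(* The map [t |-> g t] permutes [G], so a translate has the same L^2 norm. *)
have translate_ball (z : G -> R) (g : G) : l2norm z <= 1 ->
    unit_ball ([ffun t => z (g * t)%g] : l2hilbert R G).
  move=> z1; apply: le_trans z1.
  rewrite -[leRHS]ger0_norm ?l2norm_ge0 // -sqrtr_sqr l2norm_sqr ler_wsqrtr //.
  rewrite /l2inner /avg [in leRHS](reindex_inj (mulgI g)) /=.
  by under eq_bigr => t do rewrite !ffunE.
exists (l2hilbert R G), (fun g => [ffun t => x (g * t)%g]),
  (fun g => [ffun t => y (g * t)%g]); split.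
- by move=> g; exact: translate_ball.
- by move=> g; exact: translate_ball.
- by congr (`|_|%:E); exact: group_form_l2inner.
Qed.

(** The bound is a real [c], so that the argument stays within real arithmetic; it is later applied
    to a finite spectral norm. *)
Lemma hilbert_form_le (R : realType) (G : finGroupType) (f : G -> R) (c : R) :
  (forall x y, l2norm x <= 1 -> l2norm y <= 1 -> `|group_form f x y| <= c) ->
  forall (H : hilbertSpace R) (x y : G -> H),
    (forall g, unit_ball (x g)) -> (forall h, unit_ball (y h)) ->
    `|avg (fun g => avg (fun h => f (g * h^-1)%g * inner H (x g) (y h)))| <= c.
Proof.
move=> fc H x y x1 y1.
have c0 : 0 <= c.
  apply: le_trans (normr_ge0 _) (fc (fun=> 0) (fun=> 0) _ _);
  by rewrite /l2norm normr0 expr0n /= avg_cst sqrtr0.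
(* Joining both families gives them common coordinates: the mixed inner products expand the form,
   the diagonal ones control the norms. *)
pose v (i : G + G) := match i with inl g => x g | inr g => y g end.
have [n [a aE]] := gram_factorization (enum {: G + G}) v.
pose xk k g := a k (inl g); pose yk k g := a k (inr g).
have -> : avg (fun g => avg (fun h => f (g * h^-1)%g * inner H (x g) (y h))) =
    \sum_(k < n) group_form f (xk k) (yk k).
  pose F k g h := f (g * h^-1)%g * xk k g * yk k h.
  rewrite /group_form -(avg_sum n (fun k g => avg (F k g))).
  apply: eq_avg => g; rewrite -(avg_sum n (fun k h => F k g h)).
  apply: eq_avg => h.
  rewrite (aE (inl g) (inr h)) ?mem_enum // mulr_sumr.
  by apply: eq_bigr => k _; rewrite mulrA.
(* Exchanging sum and average turns the left side into the average of the squared norms of [z g]. *)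
have sum_le1 (z : G -> H) (zk : nat -> G -> R) : (forall g, unit_ball (z g)) ->
    (forall g, inner H (z g) (z g) = \sum_(k < n) zk k g * zk k g) ->
    \sum_(k < n) l2norm (zk k) ^+ 2 <= 1.
  move=> z1 zE; under eq_bigr => k _ do rewrite l2norm_sqr.
  rewrite -(avg_sum n (fun k g => zk k g * zk k g)); apply: avg_le1 => g.
  by rewrite -zE inner_normE expr_le1 //; exact: z1.
have sx : \sum_(k < n) l2norm (xk k) ^+ 2 <= 1.
  by apply: (sum_le1 x) => // g; rewrite (aE (inl g) (inl g)) ?mem_enum.
have sy : \sum_(k < n) l2norm (yk k) ^+ 2 <= 1.
  by apply: (sum_le1 y) => // g; rewrite (aE (inr g) (inr g)) ?mem_enum.
apply: le_trans (ler_norm_sum _ _ _) _.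
(* By [2 p q <= p^2 + q^2], the bound becomes additive in the squared norms, and the total is at
   most [c / 2 * (1 + 1)]. *)
have step (k : 'I_n) : `|group_form f (xk k) (yk k)| <=
    c / 2 * (l2norm (xk k) ^+ 2 + l2norm (yk k) ^+ 2).
  apply: le_trans (group_form_le fc _ _) _.
  rewrite -mulrA ler_wpM2l //.
  have := sqr_ge0 (l2norm (xk k) - l2norm (yk k)); rewrite sqrrB; lra.
apply: le_trans (ler_sum _ (fun k _ => step k)) _.
rewrite -mulr_sumr big_split /=; nra.
Qed.

Theorem theorem3p1 (R : realType) (G : finGroupType) (f : G -> R) :
  spectral_norm f = grothendieck_norm f.
Proof.
apply/eqP; rewrite eq_le spectral_le_grothendieck /=.
have spectral_ub (x y : G -> R) : l2norm x <= 1 -> l2norm y <= 1 ->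
    (`|group_form f x y|%:E <= spectral_norm f)%E.
  by move=> x1 y1; apply: ereal_sup_ubound; exists x, y.
apply: ge_ereal_sup => _ [H [x [y [x1 y1 ->]]]].
(* A supremum of [-oo] is excluded by the zero functions, which are admissible and give a real
   value. *)
case: (spectral_norm f) spectral_ub => [c| |] spectral_ub.
- by rewrite lee_fin; apply: hilbert_form_le.
- exact: leey.
- have := spectral_ub (fun=> 0) (fun=> 0).
  rewrite /l2norm normr0 expr0n /= avg_cst sqrtr0 => /(_ ler01 ler01).
  by rewrite leeNy_eq.
Qed.
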